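(* There is an absolute constant $c>0$ such that the following holds. Let $N\ge 1$, let $f:\{0,1\}^N\to\{0,1\}$ be a function, and let $\tilde{Q}_2(f)$ be its bounded-error query complexity in the Hamiltonian oracle model. Then for every nonzero adversary matrix $\Gamma$ for $f$ (a symmetric $2^N\times 2^N$ matrix with non-negative real entries, indexed by $\{0,1\}^N\times\{0,1\}^N$, such that $\Gamma[x,y]=0$ whenever $f(x)=f(y)$), \[ \tilde{Q}_2(f)\;\ge\; c\cdot\frac{\lambda(\Gamma)}{\max_{1\le j\le N}\lambda(\Gamma_j)}, \] where $\lambda(\cdot)$ denotes the spectral norm and $\Gamma_j$ is the matrix with $\Gamma_j[x,y]=\Gamma[x,y]$ if $x_j\ne y_j$ and $\Gamma_j[x,y]=0$ if $x_j=y_j$. That is, $\tilde{Q}_2(f)=\Omega\big(\lambda(\Gamma)/\max_j\lambda(\Gamma_j)\big)$.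
   Context: Hamiltonian oracle model. The state space is a finite-dimensional complex Hilbert space $\mathcal H$ with mutually orthogonal subspaces $V_1,\dots,V_N$; $P_j$ denotes the orthogonal projection onto $V_j$. For each $j\in\{1,\dots,N\}$ there are two Hermitian operators $H_j^{(0)},H_j^{(1)}$ on $\mathcal H$ with $H_j^{(b)}=P_jH_j^{(b)}P_j$ and operator norm $\|H_j^{(b)}\|\le 1$ for $b\in\{0,1\}$. For an input $x=x_1x_2\cdots x_N\in\{0,1\}^N$ the Hamiltonian oracle is the time-independent operator \[ H_Q(x)=\sum_{j=1}^N H_j^{(x_j)}. \] An algorithm running for time $T\ge 0$ consists of: an initial unit vector $|\psi^0\rangle\in\mathcal H$ independent of $x$; a real-valued function $g$ on $[0,T]$ with $|g(t)|\le 1$; a Hermitian-operator-valued driver Hamiltonian $H_D(t)$, $t\in[0,T]$, independent of $x$ ($g$ and $H_D$ being regular enough, e.g. piecewise continuous, for the evolution below to be well defined); and a final measurement, independent of $x$, with an output in $\{0,1\}$. On input $x$ the state $|\psi_x^t\rangle$ starts at $|\psi_x^0\rangle=|\psi^0\rangle$ and evolves by the Schrödinger equation \[ i\frac{d}{dt}|\psi_x^t\rangle=H_x(t)|\psi_x^t\rangle,\qquad H_x(t)=g(t)H_Q(x)+H_D(t), \] for $t\in[0,T]$, and then $|\psi_x^T\rangle$ is measured to produce the output. The algorithm computes $f$ with bounded error if for every $x\in\{0,1\}^N$ the output equals $f(x)$ with probability at least $2/3$. The bounded-error query complexity $\tilde{Q}_2(f)$ in the Hamiltonian oracle model is the minimum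 (infimum) time $T$ for which there is an algorithm of this form, running for time $T$, that computes $f$ with bounded error. The constant $c$ does not depend on $N$, $f$, $\Gamma$, $\mathcal H$, the subspaces $V_j$, or the operators $H_j^{(b)}$. The spectral norm $\lambda(M)$ of a matrix $M$ is its largest singular value. If $\Gamma\neq 0$ then some $\Gamma_j$ is nonzero, so the ratio is well defined. *)

(* Defs.v *)
From mathcomp Require Import all_boot all_order all_algebra spectral.
From mathcomp Require Import all_classical all_reals all_analysis.
From mathcomp.real_closed Require Import complex.

Set Implicit Arguments.
Unset Strict Implicit.
Unset Printing Implicit Defensive.

Import Order.TTheory GRing.Theory Num.Theory.
Import numFieldNormedType.Exports.

Local Open Scope classical_set_scope.
Local Open Scope ring_scope.
Local Open Scope complex_scope.
Local Open Scope sesquilinear_scope.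

Section HilbertSpace.
Variables (R : realType) (d : nat).

(* The state space is C^d with its standard inner product, conjugate-linear
   in the first argument; operators are matrices acting on column vectors. *)
Definition hdot (u v : 'cV[R[i]]_d) : R[i] := (u^t* *m v) 0 0.

Definition hnorm (u : 'cV[R[i]]_d) : R := Num.sqrt (complex.Re (hdot u u)).

Definition opnorm (A : 'M[R[i]]_d) : R :=
  sup [set hnorm (A *m u) | u in [set u | hnorm u = 1]].

Definition orthogonal_projection
    (V : {vspace 'cV[R[i]]_d}) (P : 'M[R[i]]_d) : Prop :=
  forall u, P *m u \in V /\ forall v, v \in V -> hdot v (u - P *m u) = 0.

(* The order of R[i] is such that 0 <= z forces z to be real. *)
Definition psd (A : 'M[R[i]]_d) : Prop :=
  A \is hermsymmx /\ forall u, 0 <= hdot u (A *m u).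

End HilbertSpace.

Section TimeDependence.
Variable R : realType.

Definition re_im_entries (Q : (R -> R) -> Prop) (m n : nat)
    (A : R -> 'M[R[i]]_(m, n)) : Prop :=
  forall i j, Q (fun t => complex.Re (A t i j)) /\
              Q (fun t => complex.Im (A t i j)).

(* Piecewise continuity on [0, T], with breakpoints among the elements of s
   and finite one-sided limits everywhere. *)
Definition pw_continuous (T : R) (s : seq R) (h : R -> R) : Prop :=
  [/\ forall t : R, 0 < t < T -> t \notin s -> {for t, continuous h},
      forall t : R, 0 <= t < T -> cvg (h @ t^'+) &
      forall t : R, 0 < t <= T -> cvg (h @ t^'-)].

Definition has_deriv (d : nat) (psi : R -> 'cV[R[i]]_d) (t : R)
    (v : 'cV[R[i]]_d) : Prop :=
  forall k,
    is_derive t (1 : R) (fun s => complex.Re (psi s k 0)) (complex.Re (v k 0))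
    /\
    is_derive t (1 : R) (fun s => complex.Im (psi s k 0)) (complex.Im (v k 0)).

End TimeDependence.

Definition input (N : nat) : finType := {ffun 'I_N -> bool}.

Section Model.
Variables (R : realType) (N d : nat).

Record oracle := Oracle {
  subsp : 'I_N -> {vspace 'cV[R[i]]_d};
  proj : 'I_N -> 'M[R[i]]_d;
  ham : 'I_N -> bool -> 'M[R[i]]_d;
  subsp_orth : forall j k, j != k ->
    forall u v, u \in subsp j -> v \in subsp k -> hdot u v = 0;
  proj_orth : forall j, orthogonal_projection (subsp j) (proj j);
  ham_herm : forall j b, ham j b \is hermsymmx;
  ham_proj : forall j b, ham j b = proj j *m ham j b *m proj j;
  ham_norm : forall j b, opnorm (ham j b) <= 1 }.

Definition oracle_ham (O : oracle) (x : input N) : 'M[R[i]]_d :=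
  \sum_(j < N) ham O j (x j).

(* The functions of time are total, but only constrained on [0, T]. The final
   measurement is a two-outcome POVM. *)
Record algorithm (T : R) := Algorithm {
  psi0 : 'cV[R[i]]_d;
  gain : R -> R;
  driver : R -> 'M[R[i]]_d;
  breaks : seq R;
  povm : bool -> 'M[R[i]]_d;
  psi0_unit : hnorm psi0 = 1;
  gain_le1 : forall t : R, 0 <= t <= T -> `|gain t| <= 1;
  gain_pwc : pw_continuous T breaks gain;
  driver_herm : forall t : R, 0 <= t <= T -> driver t \is hermsymmx;
  driver_pwc : re_im_entries (pw_continuous T breaks) driver;
  povm_psd : forall b, psd (povm b);
  povm_sum : povm false + povm true = 1%:M }.

Definition total_ham (O : oracle) (T : R) (A : algorithm T) (x : input N)
    (t : R) : 'M[R[i]]_d :=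
  (gain A t)%:C *: oracle_ham O x + driver A t.

(* Solutions for a piecewise continuous Hamiltonian: continuous on [0, T] and
   differentiable away from the breakpoints; they exist and are unique. *)
Definition evolution (O : oracle) (T : R) (A : algorithm T) (x : input N)
    (psi : R -> 'cV[R[i]]_d) : Prop :=
  [/\ psi 0 = psi0 A,
      re_im_entries (fun h => {within `[0, T], continuous h}) psi &
      forall t : R, 0 < t < T -> t \notin breaks A ->
        exists2 v, has_deriv psi t v & 'i *: v = total_ham O A x t *m psi t].

Definition output_prob (T : R) (A : algorithm T) (u : 'cV[R[i]]_d)
    (b : bool) : R :=
  complex.Re (hdot u (povm A b *m u)).

Definition computes (O : oracle) (T : R) (A : algorithm T)
    (f : input N -> bool) : Prop :=
  forall x, exists2 psi, evolution O A x psi &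
    2 / 3 <= output_prob A (psi T) (f x).

(* Extended-real valued: +oo when no algorithm computes f with this oracle. *)
Definition Q2 (O : oracle) (f : input N -> bool) : \bar R :=
  ereal_inf [set T%:E | T in
    [set T : R | 0 <= T /\ exists A : algorithm T, computes O A f]].

End Model.

Section Adversary.
Variable R : realType.

(* Largest singular value of a real matrix. *)
Definition spectral_norm (n : nat) (M : 'M[R]_n) : R :=
  sup [set s : R | 0 <= s /\ eigenvalue (M^T *m M) (s ^+ 2)].

(* Rows and columns stand for the inputs through enum_val. *)
Definition adversary_matrix (N : nat) (f : input N -> bool)
    (Gamma : 'M[R]_#|input N|) : Prop :=
  [/\ Gamma^T = Gamma,
      forall a b, 0 <= Gamma a b &
      forall a b, f (enum_val a) = f (enum_val b) -> Gamma a b = 0].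

Definition adv_restrict (N : nat) (Gamma : 'M[R]_#|input N|) (j : 'I_N) :
    'M[R]_#|input N| :=
  \matrix_(a, b) if (enum_val a : input N) j != (enum_val b : input N) j
                  then Gamma a b else 0.

End Adversary.

(* Main.v *)
(* Fix a nonnegative vector delta and follow W t = sum_{x,y} Gamma[x,y]
   delta_x delta_y Re <psi_x^t | psi_y^t>. At time 0 this is the quadratic form
   of Gamma at delta. At time T every overlap between inputs with different
   values of f is at most 33/35, because the final measurement distinguishes
   them, so W has lost at least a fraction 2/35. In between, the driver cancels
   from d/dt <psi_x | psi_y>, and only the H_j with x_j <> y_j contribute, each
   at most 2 |P_j psi_x| |P_j psi_y|. Summing against Gamma bounds |W'| by
   2 sum_j lambda(Gamma_j) sum_x delta_x^2 |P_j psi_x|^2, hence by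
   2 max_j lambda(Gamma_j) |delta|^2, as the P_j have orthogonal ranges. Taking
   for delta the absolute values of an eigenvector of Gamma gives the theorem
   with c = 1/35. *)
From mathcomp Require Import all_boot all_order all_algebra spectral.
From mathcomp Require Import all_classical all_reals all_analysis.
From mathcomp.real_closed Require Import complex.
From mathcomp Require Import ring lra.
Require Import Defs.

Set Implicit Arguments.
Unset Strict Implicit.
Unset Printing Implicit Defensive.

Import Order.TTheory GRing.Theory Num.Theory.
Import numFieldNormedType.Exports.

Local Open Scope classical_set_scope.
Local Open Scope ring_scope.
Local Open Scope complex_scope.
Local Open Scope sesquilinear_scope.

(** * Real inner product on the state space, operator bounds and measurement *)

Section RealInnerProduct.
Variables (R : realType) (d : nat).
Implicit Types (u v w : 'cV[R[i]]_d) (A : 'M[R[i]]_d).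

Lemma Re_sum (I : Type) (r : seq I) (P : pred I) (F : I -> R[i]) :
  complex.Re (\sum_(k <- r | P k) F k) = \sum_(k <- r | P k) complex.Re (F k).
Proof. by apply: (big_morph (@complex.Re R)) => // -[? ?] [? ?]. Qed.

(** This is the Euclidean inner product of C^d seen as R^(2d); the overlaps enter the progress
    function only through it. *)
Definition rdot u v : R := complex.Re (hdot u v).

Lemma rdotE u v : rdot u v = \sum_k
  (complex.Re (u k 0) * complex.Re (v k 0) +
   complex.Im (u k 0) * complex.Im (v k 0)).
Proof.
rewrite /rdot /hdot mxE Re_sum; apply: eq_bigr => k _; rewrite !mxE.
by case: (u k 0) (v k 0) => [a b] [c e] /=; ring.
Qed.

Lemma rdotC u v : rdot u v = rdot v u.
Proof. by rewrite !rdotE; apply: eq_bigr => k _; ring. Qed.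

Lemma rdotDr u v w : rdot u (v + w) = rdot u v + rdot u w.
Proof.
rewrite !rdotE -big_split; apply: eq_bigr => k _; rewrite mxE.
by case: (u k 0) (v k 0) (w k 0) => [? ?] [? ?] [? ?] /=; ring.
Qed.

Lemma rdotZr a u v : rdot u (a%:C *: v) = a * rdot u v.
Proof.
rewrite !rdotE mulr_sumr; apply: eq_bigr => k _; rewrite mxE.
by case: (u k 0) (v k 0) => [? ?] [? ?] /=; ring.
Qed.

Lemma rdotNr u v : rdot u (- v) = - rdot u v.
Proof.
rewrite !rdotE -sumrN; apply: eq_bigr => k _; rewrite mxE.
by case: (u k 0) (v k 0) => [? ?] [? ?] /=; ring.
Qed.

Lemma rdot0r u : rdot u 0 = 0.
Proof. by rewrite -(subrr u) rdotDr rdotNr subrr. Qed.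

Lemma rdotDl u v w : rdot (u + v) w = rdot u w + rdot v w.
Proof. by rewrite ![rdot _ w]rdotC rdotDr. Qed.

Lemma rdotNl u v : rdot (- u) v = - rdot u v.
Proof. by rewrite ![rdot _ v]rdotC rdotNr. Qed.

Lemma rdotZl a u v : rdot (a%:C *: u) v = a * rdot u v.
Proof. by rewrite ![rdot _ v]rdotC rdotZr. Qed.

Lemma rdot_sumr (I : Type) (r : seq I) (P : pred I) u (F : I -> 'cV[R[i]]_d) :
  rdot u (\sum_(k <- r | P k) F k) = \sum_(k <- r | P k) rdot u (F k).
Proof.
by apply: (big_morph (rdot u)) => [v w|]; rewrite ?rdotDr ?rdot0r.
Qed.

Lemma rdot_ge0 u : 0 <= rdot u u.
Proof. by rewrite rdotE sumr_ge0// => k _; rewrite -!expr2 addr_ge0 ?sqr_ge0. Qed.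

Lemma hnorm_ge0 u : 0 <= hnorm u.
Proof. exact: sqrtr_ge0. Qed.

Lemma hnorm_sqr u : hnorm u ^+ 2 = rdot u u.
Proof. by rewrite sqr_sqrtr ?rdot_ge0. Qed.

Lemma hnorm_eq0 u : hnorm u = 0 -> u = 0.
Proof.
move=> u0; have /eqP : rdot u u = 0 by rewrite -hnorm_sqr u0 expr0n.
rewrite rdotE psumr_eq0 => [/allP h|k _]; last first.
  by rewrite -!expr2 addr_ge0 ?sqr_ge0.
apply/colP => k; rewrite mxE; have := h k (mem_index_enum k).
rewrite -!expr2 paddr_eq0 ?sqr_ge0// !sqrf_eq0.
by case: (u k 0) => a b /= /andP[/eqP -> /eqP ->].
Qed.

Lemma rdot_le u v : rdot u v <= hnorm u * hnorm v.
Proof.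
have [/hnorm_eq0 ->|u0] := eqVneq (hnorm u) 0.
  by rewrite rdotC rdot0r mulr_ge0 ?hnorm_ge0.
have [/hnorm_eq0 ->|v0] := eqVneq (hnorm v) 0.
  by rewrite rdot0r mulr_ge0 ?hnorm_ge0.
have uv : 0 < hnorm u * hnorm v by rewrite mulr_gt0 ?lt0r ?u0 ?v0 ?hnorm_ge0.
(* Expanding gives [2 * uv * (uv - rdot u v) >= 0] with [uv = hnorm u * hnorm v > 0]. *)
have := rdot_ge0 ((hnorm v)%:C *: u - (hnorm u)%:C *: v).
rewrite rdotDl !rdotDr !rdotNl !rdotNr !rdotZl !rdotZr -!hnorm_sqr [rdot v u]rdotC.
move=> h; rewrite -(ler_pM2l uv); lra.
Qed.

Lemma normr_rdot_le u v : `|rdot u v| <= hnorm u * hnorm v.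
Proof.
rewrite ler_norml rdot_le andbT lerNl -rdotNl (le_trans (rdot_le _ _))//.
suff -> : hnorm (- u) = hnorm u by [].
by rewrite /hnorm -/(rdot _ _) rdotNl rdotNr opprK.
Qed.

Lemma hdot_adj A u v : hdot (A *m u) v = hdot u (A^t* *m v).
Proof. by rewrite /hdot trmx_mul map_mxM mulmxA. Qed.

Lemma hermsymmx_adj A : A \is hermsymmx -> A^t* = A.
Proof. by move=> /is_hermitianmxP {2}->; rewrite expr0 scale1r. Qed.

Lemma rdot_herm A u v : A \is hermsymmx -> rdot (A *m u) v = rdot u (A *m v).
Proof. by move=> Ah; rewrite /rdot hdot_adj hermsymmx_adj. Qed.

Lemma hdot_conj u v : hdot v u = (hdot u v)^*.
Proof.
rewrite /hdot !mxE rmorph_sum; apply: eq_bigr => k _.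
by rewrite !mxE rmorphM/= conjcK mulrC.
Qed.

(** Multiplication by ['i] is an isometry, so a Schrödinger equation ['i v = H psi] can be inserted
    without dividing by ['i]. *)
Lemma rdot_imag u v : rdot ('i%R *: u) ('i%R *: v) = rdot u v.
Proof.
rewrite /rdot /hdot !mxE; congr complex.Re; apply: eq_bigr => k _.
rewrite !mxE rmorphM/= mulrACA.
have -> : Num.conj 'i%R * 'i%R = 1 :> R[i].
  by rewrite conjCi mulNr -expr2 sqrCi opprK.
by rewrite mul1r.
Qed.

Lemma rdot_imagl u v : rdot ('i%R *: u) v = - rdot u ('i%R *: v).
Proof.
by rewrite -[in LHS]rdot_imag scalerA -expr2 sqrCi scaleN1r rdotNl.
Qed.

Lemma hnorm_imag u : hnorm ('i%R *: u) = hnorm u.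
Proof. by rewrite /hnorm -!/(rdot _ _) rdot_imag. Qed.

Lemma hdot_normc u : hdot u u = \sum_k `|u k 0| ^+ 2.
Proof.
by rewrite /hdot mxE; apply: eq_bigr => k _; rewrite !mxE normCK mulrC.
Qed.

(** A [sup] says nothing about an unbounded set, so [opnorm] needs this. Entries of a unit vector
    have modulus at most 1, so absolute row sums of [A] bound the entries of [A *m u]. *)
Lemma opnorm_has_ubound A :
  has_ubound [set hnorm (A *m u) | u in [set u | hnorm u = 1]].
Proof.
pose B := \sum_i (\sum_k `|A i k|) ^+ 2.
exists (Num.sqrt (complex.Re B)) => _ [u /= u1 <-].
have u2 : \sum_k `|u k 0| ^+ 2 = 1.
  rewrite -hdot_normc; apply/eqP; rewrite eq_complex.
  move: (hnorm_sqr u); rewrite u1 expr1n /rdot => <-; rewrite eqxx/=.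
  by rewrite hdot_normc ger0_Im// sumr_ge0// => k _; rewrite exprn_ge0.
have uk k : `|u k 0| <= 1.
  rewrite -(@ler_pXn2r _ 2) ?nnegrE// expr1n -u2 (bigD1 k)//= lerDl.
  by rewrite sumr_ge0// => l _; rewrite exprn_ge0.
apply: ler_wsqrtr.
suff : hdot (A *m u) (A *m u) <= B by rewrite lecE => /andP[].
rewrite hdot_normc; apply: ler_sum => i _.
rewrite ler_pXn2r ?nnegrE ?sumr_ge0// mxE (le_trans (ler_norm_sum _ _ _))//.
by apply: ler_sum => k _; rewrite normrM ler_piMr.
Qed.

Lemma hnormZ a u : 0 <= a -> hnorm (a%:C *: u) = a * hnorm u.
Proof.
move=> a0; rewrite /hnorm -!/(rdot _ _) rdotZl rdotZr mulrA -expr2.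
by rewrite sqrtrM ?sqr_ge0// sqrtr_sqr ger0_norm.
Qed.

Lemma hnorm_mulmx A u : hnorm (A *m u) <= opnorm A * hnorm u.
Proof.
have [u0|u0] := eqVneq (hnorm u) 0.
  by rewrite u0 mulr0 (hnorm_eq0 u0) mulmx0 /hnorm -/(rdot _ _) rdot0r sqrtr0.
have up : 0 < hnorm u by rewrite lt0r u0 hnorm_ge0.
have u1 : hnorm ((hnorm u)^-1%:C *: u) = 1.
  by rewrite hnormZ ?invr_ge0 ?hnorm_ge0// mulVf.
rewrite -ler_pdivrMr// mulrC -hnormZ ?invr_ge0 ?hnorm_ge0// scalemxAr.
by apply: ub_le_sup; [exact: opnorm_has_ubound|exists ((hnorm u)^-1%:C *: u)].
Qed.

(** Self-adjointness follows from the geometric definition: both sides equal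
    [hdot (P *m u) (P *m v)]. *)
Lemma hdot_projection V (P : 'M[R[i]]_d) u v : orthogonal_projection V P ->
  hdot u (P *m v) = hdot (P *m u) v.
Proof.
move=> hP; have h a b : hdot (P *m a) b = hdot (P *m a) (P *m b).
  have /(_ (P *m a) (hP a).1) := (hP b).2.
  by rewrite /hdot mulmxBr mxE [X in _ + X]mxE => /eqP; rewrite subr_eq0 => /eqP.
by rewrite (h u v) hdot_conj (h v u) -hdot_conj.
Qed.

(* AM-GM on each outcome. The weight 7/10 is a rational substitute for the
   optimal sqrt (1/2), which would give 2 sqrt 2 / 3 instead of 33/35. *)
Lemma povm_overlap (E0 E1 : 'M[R[i]]_d) u v :
  psd E0 -> psd E1 -> E0 + E1 = 1%:M -> hnorm u = 1 -> hnorm v = 1 ->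
  2 / 3 <= rdot u (E0 *m u) -> 2 / 3 <= rdot v (E1 *m v) ->
  rdot u v <= 33 / 35.
Proof.
move=> [h0 p0] [h1 p1] E01 u1 v1 hu hv.
have split w z : rdot w z = rdot w (E0 *m z) + rdot w (E1 *m z).
  by rewrite -rdotDr -mulmxDl E01 mul1mx.
have weighted E a b : psd E ->
    2 * (a * b) * rdot u (E *m v) <=
    a ^+ 2 * rdot u (E *m u) + b ^+ 2 * rdot v (E *m v).
  move=> [hE pE]; have := pE (a%:C *: u - b%:C *: v).
  rewrite lecE => /andP[_]; rewrite /= -/(rdot _ _).
  rewrite mulmxBr -!scalemxAr rdotDl !rdotDr !rdotNl !rdotNr !rdotZl !rdotZr.
  rewrite [rdot v (E *m u)]rdotC rdot_herm//.
  move: (rdot u (E *m u)) (rdot v (E *m v)) (rdot u (E *m v)).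
  by clear=> p q r; lra.
(* The smaller square 49 goes to the likely outcome of each state. The sum reads [140 * rdot u v <=
   200 - 51 * (4 / 3) = 132], that is 33/35. *)
have := weighted E0 7 10 (conj h0 p0); have := weighted E1 10 7 (conj h1 p1).
have := hnorm_sqr u; have := hnorm_sqr v; rewrite u1 v1 expr1n.
rewrite (split u u) (split v v) (split u v); move: hu hv.
move: (rdot u (E0 *m u)) (rdot u (E1 *m u)) (rdot v (E0 *m v)).
move: (rdot v (E1 *m v)) (rdot u (E0 *m v)) (rdot u (E1 *m v)).
by clear=> p q r p' q' r'; lra.
Qed.

(** Here [P j] is a vector, the component of [u] in the j-th subspace. The inequality is
    nonnegativity of the squared norm of [u - \sum_j P j]. *)
Lemma Bessel (N : nat) (P : 'I_N -> 'cV[R[i]]_d) u :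
  (forall j, rdot (P j) u = rdot (P j) (P j)) ->
  (forall j k, j != k -> rdot (P j) (P k) = 0) ->
  \sum_j rdot (P j) (P j) <= rdot u u.
Proof.
move=> Pu Po; set s := \sum_j _; pose w := \sum_j P j.
have us : rdot u w = s.
  by rewrite rdot_sumr; apply: eq_bigr => j _; rewrite rdotC Pu.
have ws : rdot w w = s.
  rewrite rdot_sumr; apply: eq_bigr => j _; rewrite rdotC rdot_sumr.
  by rewrite (bigD1 j)//= big1 ?addr0// => k kj; rewrite Po// eq_sym.
have := rdot_ge0 (u - w).
rewrite rdotDl !rdotDr !rdotNl !rdotNr [rdot w u]rdotC us ws.
by move: {us ws}s (rdot u u); clear=> s r; lra.
Qed.
End RealInnerProduct.

(** * Bounds on the oracle Hamiltonian *)

Section Oracle.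
Variables (R : realType) (N d : nat) (O : oracle R N d).
Implicit Types (u v : 'cV[R[i]]_d) (x y : input N).

Lemma oracle_Bessel u : \sum_j hnorm (proj O j *m u) ^+ 2 <= hnorm u ^+ 2.
Proof.
rewrite hnorm_sqr; under eq_bigr do rewrite hnorm_sqr.
apply: Bessel => [j|j k jk].
  have [uV] := proj_orth O j u; move=> /(_ _ uV).
  rewrite /rdot /hdot mulmxBr mxE [X in _ + X]mxE => /eqP.
  by rewrite subr_eq0 => /eqP ->.
rewrite /rdot (@subsp_orth _ _ _ O _ _ jk) ?(proj_orth O _ _).1//.
Qed.

(** Since [H = P H P], a projection can be moved onto each argument before Cauchy-Schwarz and the
    norm bound on [H] are applied. *)
Lemma ham_rdot j b u v :
  `|rdot (ham O j b *m u) v| <= hnorm (proj O j *m u) * hnorm (proj O j *m v).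
Proof.
have -> : rdot (ham O j b *m u) v =
    rdot (ham O j b *m (proj O j *m u)) (proj O j *m v).
  rewrite [in LHS]ham_proj -!mulmxA /rdot.
  by rewrite (hdot_projection _ _ (proj_orth O j)).
apply: (le_trans (normr_rdot_le _ _)); apply: ler_wpM2r; first exact: hnorm_ge0.
apply: (le_trans (hnorm_mulmx _ _)).
by rewrite ler_piMl ?hnorm_ge0 ?ham_norm.
Qed.

(** Terms with [x j = y j] cancel. In the others two different Hamiltonians remain, each bounded by
    [ham_rdot], whence the factor 2. *)
Lemma ham_diff_rdot x y u v :
  `|rdot ((oracle_ham O x - oracle_ham O y) *m u) v| <=
  \sum_j ((x j != y j)%:R *
     (2 * (hnorm (proj O j *m u) * hnorm (proj O j *m v)))).
Proof.
rewrite /oracle_ham -sumrB mulmx_suml rdotC rdot_sumr.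
apply: (le_trans (ler_norm_sum _ _ _)); apply: ler_sum => j _.
case: eqVneq => [->|_]; first by rewrite subrr mul0mx rdot0r normr0 mul0r.
rewrite mul1r mulmxBl rdotDr rdotNr (le_trans (ler_normB _ _))//.
rewrite mulrDl mul1r; apply: lerD; rewrite rdotC; exact: ham_rdot.
Qed.

End Oracle.

(** * Continuity, derivatives and a mean value inequality with breakpoints *)

Section Calculus.
Variable R : realType.

Lemma within_continuous_sum (I : Type) (r : seq I) (S : set R) (F : I -> R -> R) :
  (forall i, {within S, continuous (F i)}) ->
  {within S, continuous (fun t => \sum_(i <- r) F i t)}.
Proof.
move=> FS; elim: r => [|i r IH].
  under eq_fun do rewrite big_nil.
  by move=> t; apply: cvg_cst.
under eq_fun do rewrite big_cons.
by move=> t; apply: cvgD; [exact: FS|exact: IH].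
Qed.

Lemma within_continuous_mul (S : set R) (f g : R -> R) :
  {within S, continuous f} -> {within S, continuous g} ->
  {within S, continuous (fun t => f t * g t)}.
Proof. by move=> fS gS t; apply: cvgM; [exact: fS|exact: gS]. Qed.

(** Induction on [s], an arbitrary list: its head may lie outside the interval or recur later.
    Continuity of [h] lets the estimates on both sides of a breakpoint be added. *)
Lemma mean_value_breakpoints (s : seq R) (h dh : R -> R) (K a b : R) : a <= b ->
  {within `[a, b], continuous h} ->
  (forall t, a < t < b -> t \notin s -> is_derive t 1 h (dh t)) ->
  (forall t, a < t < b -> t \notin s -> `|dh t| <= K) ->
  `|h b - h a| <= K * (b - a).
Proof.
elim: s a b => [|x s IH] a b; rewrite le_eqVlt => /predU1P[-> *|ab hc hd hK].
- by rewrite !subrr normr0 mulr0.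
- have [t tab|c cab ->] := @MVT R h dh a b ab _ hc.
    by apply: hd => //; move: tab; rewrite in_itv.
  rewrite normrM [`|b - a|]gtr0_norm ?subr_gt0// ler_wpM2r ?subr_ge0 ?(ltW ab)//.
  by apply: hK => //; move: cab; rewrite in_itv.
- by rewrite !subrr normr0 mulr0.
(* On a subinterval without [x] in its interior, only the breakpoints in [s] matter and the
   induction hypothesis applies. *)
have step c e : a <= c -> e <= b -> c <= e -> ~~ (c < x < e) ->
    `|h e - h c| <= K * (e - c).
  move=> ac eb ce xce; have tab t : c < t < e -> a < t < b.
    by case/andP=> ct te; rewrite (le_lt_trans ac ct) (lt_le_trans te eb).
  have tx t : c < t < e -> t \notin s -> t \notin x :: s.
    move=> tce ts; rewrite inE negb_or ts andbT.
    by apply: contraNneq xce => <-.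
  apply: IH ce _ _ _.
  - by apply: continuous_subspaceW hc; apply: subset_itv; rewrite bnd_simp.
  - by move=> t tce ts; apply: hd; [exact: tab|exact: tx].
  - by move=> t tce ts; apply: hK; [exact: tab|exact: tx].
have [/andP[ax xb]|xab] := boolP (a < x < b); last first.
  by apply: step; rewrite ?lexx ?ltW.
have -> : h b - h a = (h x - h a) + (h b - h x) by ring.
have -> : K * (b - a) = K * (x - a) + K * (b - x) by ring.
apply: (le_trans (ler_normD _ _)); apply: lerD.
  by apply: step; rewrite ?lexx ?ltW// ltxx andbF.
by apply: step; rewrite ?lexx ?ltW// ltxx.
Qed.

Variable d : nat.

Lemma rdot_continuous (S : set R) (p q : R -> 'cV[R[i]]_d) :
  re_im_entries (fun h => {within S, continuous h}) p ->
  re_im_entries (fun h => {within S, continuous h}) q ->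
  {within S, continuous (fun t => rdot (p t) (q t))}.
Proof.
move=> pS qS; under eq_fun do rewrite rdotE.
apply: within_continuous_sum => k t; have [pr pi] := pS k 0; have [qr qi] := qS k 0.
by apply: cvgD; apply: cvgM; [exact: pr|exact: qr|exact: pi|exact: qi].
Qed.

Lemma rdot_derive (p q : R -> 'cV[R[i]]_d) (t : R) v w :
  has_deriv p t v -> has_deriv q t w ->
  is_derive t 1 (fun s => rdot (p s) (q s)) (rdot v (q t) + rdot (p t) w).
Proof.
move=> pv qw.
(* Built with operations on functions, the form to which the sum and product rules apply. *)
pose F (k : 'I_d) : R -> R :=
  (fun s => complex.Re (p s k 0)) * (fun s => complex.Re (q s k 0))
  + (fun s => complex.Im (p s k 0)) * (fun s => complex.Im (q s k 0)).
have -> : (fun s => rdot (p s) (q s)) = \sum_(k < d) F k.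
  by apply/funext => s; rewrite rdotE fct_sumE.
pose dF (k : 'I_d) : R :=
  (complex.Re (v k 0) * complex.Re (q t k 0) +
   complex.Im (v k 0) * complex.Im (q t k 0)) +
  (complex.Re (p t k 0) * complex.Re (w k 0) +
   complex.Im (p t k 0) * complex.Im (w k 0)).
have FdF k : is_derive t 1 (F k) (dF k).
  have [pr pi] := pv k; have [qr qi] := qw k.
  apply: (is_derive_eq (is_deriveD (is_deriveM pr qr) (is_deriveM pi qi))).
  rewrite /dF /GRing.scale/=; move: (complex.Re _) (complex.Im _).
  by clear=> a b; ring.
apply: (is_derive_eq (is_derive_sum FdF)).
by rewrite (rdotE v) (rdotE (p t)) -big_split.
Qed.
End Calculus.

(** * Quadratic forms and the spectral norm of symmetric nonnegative matrices *)

Section SpectralNorm.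
Variables (R : realType) (n : nat).
Implicit Types (M : 'M[R]_n) (v : 'I_n -> R).

Definition qform M v : R := \sum_i \sum_j M i j * (v i * v j).

(** A crude bound, whose purpose is to show that the singular values are bounded above, so that the
    [sup] in [spectral_norm] is meaningful. *)
Lemma qform_le_sum M v : (forall i j, 0 <= M i j) -> (forall i, 0 <= v i) ->
  qform M v <= (\sum_i \sum_j M i j) * \sum_i v i ^+ 2.
Proof.
move=> M0 v0; rewrite /qform mulr_suml; apply: ler_sum => i _.
rewrite mulr_suml; apply: ler_sum => j _; apply: ler_wpM2l => //.
have h k : v k ^+ 2 <= \sum_i v i ^+ 2.
  by rewrite (bigD1 k)//= lerDl sumr_ge0// => l _; rewrite sqr_ge0.
have := sqr_ge0 (v i - v j); have := h i; have := h j; nra.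
Qed.

(* If [s ^+ 2] is an eigenvalue of [M *m M], then [s] or [- s] is one of [M];
   the absolute values of the entries of an eigenvector serve as [v]. *)
Lemma nonneg_witness M s : M^T = M -> (forall i j, 0 <= M i j) ->
  0 <= s -> eigenvalue (M^T *m M) (s ^+ 2) ->
  exists v, [/\ forall i, 0 <= v i, 0 < \sum_i v i ^+ 2 &
    s * (\sum_i v i ^+ 2) <= qform M v].
Proof.
move=> Msym M0 s0 /eigenvalueP[w]; rewrite Msym mulmxA => wE w0.
have [e [u [e1 uE u0]]] : exists e : R, exists u : 'rV[R]_n,
    [/\ `|e| = 1, u *m M = (e * s) *: u & u != 0].
  (* As [w M M = s^2 w], the vector [w M + s w] is an eigenvector for [s] unless it vanishes, and
     then [w] is one for [- s]. *)
  have [w1|w1] := eqVneq (w *m M + s *: w) 0.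
    exists (-1), w; split=> //; first by rewrite normrN1.
    by rewrite mulN1r scaleNr; apply/eqP; rewrite -addr_eq0 w1.
  exists 1, (w *m M + s *: w); split=> //; first by rewrite normr1.
  rewrite mul1r mulmxDl wE scalerDr -scalemxAl scalerA expr2.
  by rewrite addrC.
exists (fun i => `|u 0 i|); split=> //.
  rewrite lt0r sumr_ge0 ?andbT; last by move=> i _; rewrite sqr_ge0.
  rewrite psumr_eq0 => [|i _]; last by rewrite sqr_ge0.
  apply: contraNN u0 => /allP h; apply/eqP/rowP => i; rewrite mxE.
  by have := h i (mem_index_enum i); rewrite sqrf_eq0 normr_eq0 => /eqP.
(* The triangle inequality applied to this form, with [M] entrywise nonnegative, leaves [qform M] at
   the absolute values. *)
have -> : s * (\sum_i `|u 0 i| ^+ 2) = `|\sum_j (u *m M) 0 j * u 0 j|.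
  rewrite uE; under [in RHS]eq_bigr do rewrite mxE -mulrA -expr2.
  rewrite -mulr_sumr normrM normrM e1 mul1r (ger0_norm s0) ger0_norm.
    by under eq_bigr do rewrite real_normK ?num_real//.
  by rewrite sumr_ge0// => i _; rewrite sqr_ge0.
rewrite /qform exchange_big/= (le_trans (ler_norm_sum _ _ _))//.
apply: ler_sum => j _; rewrite mxE normrM.
apply: (le_trans (ler_wpM2r (normr_ge0 _) (ler_norm_sum _ _ _))).
rewrite mulr_suml; apply: ler_sum => i _; rewrite normrM (ger0_norm (M0 _ _)).
by rewrite [`|u 0 i| * M i j]mulrC mulrA.
Qed.

Lemma spectral_norm_ge M s : M^T = M -> (forall i j, 0 <= M i j) ->
  0 <= s -> eigenvalue (M^T *m M) (s ^+ 2) -> s <= spectral_norm M.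
Proof.
move=> Msym M0 s0 sE; apply: ub_le_sup; last by split.
exists (\sum_i \sum_j M i j) => r [r0 /(nonneg_witness Msym M0 r0)].
move=> [v [v0 vp vr]]; rewrite -(ler_pM2r vp).
exact: le_trans vr (qform_le_sum M0 v0).
Qed.

(** The spectral theorem over [R[i]] writes the form as [\sum_k D_k |y_k|^2], with [y] the
    coordinates of [v] in a unitary eigenbasis. Each [D_k] is real and at most [|D_k|], a singular
    value of [M]. *)
Lemma qform_le_spectral_norm M v : M^T = M -> (forall i j, 0 <= M i j) ->
  qform M v <= spectral_norm M * \sum_i v i ^+ 2.
Proof.
move=> Msym M0.
pose A : 'M[R[i]]_n := map_mx (real_complex R) M.
have Ah : A \is hermsymmx.
  apply/is_hermitianmxP; rewrite expr0 scale1r; apply/matrixP => i j.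
  rewrite !mxE -[in LHS]Msym mxE. symmetry; exact: conjc_real.
have /orthomx_spectralP AE := hermitian_normalmx Ah.
have Dr := hermitian_spectral_diag_real Ah.
move: (spectral_unitarymx A) AE Dr.
set U := spectralmx A; set D := spectral_diag A => UU AE Dr.
pose r k : R := complex.Re (D 0 k).
have DE k : D 0 k = (r k)%:C.
  by rewrite RRe_real//; apply: (mxOverP Dr).
have rS k : r k <= spectral_norm M.
  apply: (@le_trans _ _ `|r k|); first exact: ler_norm.
  apply: spectral_norm_ge => //.
  rewrite real_normK ?num_real//.
  (* The known eigenvector, a row of [U], is complex, so the claim about a real eigenvalue is moved
     to [R[i]]. *)
  rewrite -(eigenvalue_map (real_complex R)) map_mxM rmorphXn/= -DE Msym -/A.
  apply/eigenvalueP; exists (row k U).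
    have UA : row k U *m A = D 0 k *: row k U.
      rewrite [X in _ *m X]AE -!mulmxA -row_mul mulKVmx ?unitarymx_unit//.
      by rewrite row_mul row_diag_mx -scalemxAl -rowE.
    by rewrite mulmxA UA -scalemxAl UA scalerA -expr2.
  apply/eqP => /(congr1 (fun X => X *m U^t* )).
  rewrite -row_mul (unitarymxP UU) mul0mx => /matrixP /(_ 0 k).
  by rewrite !mxE eqxx => /eqP; rewrite oner_eq0.
pose z : 'rV[R[i]]_n := \row_i (v i)%:C.
pose y := z *m U^t*.
have yU : y^t* = U *m z^t*.
  by rewrite trmx_mul map_mxM map_trmx trmxK -map_mx_comp (map_mx_id (@conjCK _)).
have yz : y *m y^t* = z *m z^t* by rewrite yU mulmxA mulmxKtV.
have sumy : \sum_k `|y 0 k| ^+ 2 = (\sum_i v i ^+ 2)%:C.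
  transitivity ((y *m y^t* ) 0 0).
    by rewrite mxE; apply: eq_bigr => k _; rewrite !mxE normCK.
  rewrite yz mxE rmorph_sum; apply: eq_bigr => k _.
  by rewrite !mxE [X in _ * X]conjc_real rmorphXn expr2.
have qy : (qform M v)%:C = \sum_k D 0 k * `|y 0 k| ^+ 2.
  transitivity ((z *m A *m z^t* ) 0 0).
    rewrite /qform exchange_big mxE rmorph_sum; apply: eq_bigr => i _.
    rewrite !mxE [X in _ * X]conjc_real rmorph_sum mulr_suml; apply: eq_bigr => j _.
    by rewrite !mxE !rmorphM mulrCA mulrA.
  rewrite AE invmx_unitary// !mulmxA -/y -[_ *m z^t*]mulmxA -yU.
  rewrite mxE; apply: eq_bigr => k _.
  by rewrite mul_mx_diag !mxE normCK mulrA [D 0 k * _]mulrC.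
rewrite -lecR; have -> : (spectral_norm M * \sum_i v i ^+ 2)%:C =
    (spectral_norm M)%:C * \sum_k `|y 0 k| ^+ 2 by rewrite sumy; exact: rmorphM.
rewrite qy mulr_sumr; apply: ler_sum => k _.
by rewrite DE ler_wpM2r ?exprn_ge0// lecR.
Qed.
End SpectralNorm.

(** * Evolution of the overlaps and the resulting time bound *)

Section Adversary.
Variables (R : realType) (N d : nat) (O : oracle R N d).

(** Both terms of the product rule become pairings of [p t] with ['i q t]: the first by the isometry
    ['i], the second also by moving the Hermitian Hamiltonian of [y] to the left. Their difference
    is free of the driver. *)
Lemma evolution_derive (T : R) (A : algorithm d T) x y (p q : R -> 'cV[R[i]]_d) t :
  evolution O A x p -> evolution O A y q -> 0 < t < T -> t \notin breaks A ->
  is_derive t 1 (fun s => rdot (p s) (q s))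
    (gain A t * rdot ((oracle_ham O x - oracle_ham O y) *m p t) ('i%R *: q t)).
Proof.
move=> [_ _ hp] [_ _ hq] tT ts.
have [v pv vE] := hp t tT ts; have [w qw wE] := hq t tT ts.
have t0T : 0 <= t <= T by case/andP: tT => /ltW -> /ltW ->.
have Oh z : (oracle_ham O z)^t* = oracle_ham O z.
  apply: (big_rec (fun X => X^t* = X)) => [|j X _ XE].
    by rewrite trmx0 map_mx0.
  by rewrite linearD/= map_mxD XE hermsymmx_adj ?ham_herm.
have Hh z : total_ham O A z t \is hermsymmx.
  apply/is_hermitianmxP; rewrite expr0 scale1r /total_ham.
  rewrite linearD linearZ/= map_mxD map_mxZ [X in _ = X *: _ + _]conjc_real.
  by rewrite Oh hermsymmx_adj ?driver_herm.
apply: (is_derive_eq (rdot_derive pv qw)).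
have -> : rdot v (q t) = rdot (total_ham O A x t *m p t) ('i%R *: q t).
  by rewrite -rdot_imag vE.
have -> : rdot (p t) w = - rdot (total_ham O A y t *m p t) ('i%R *: q t).
  by rewrite -rdot_imag wE rdot_imagl (rdot_herm _ _ (Hh y)) scalemxAr.
rewrite -rdotNl -rdotDl -mulmxBl -rdotZl.
by rewrite /total_ham opprD addrACA subrr addr0 -scalerBr -scalemxAl.
Qed.

Lemma evolution_norm (T : R) (A : algorithm d T) x p t : 0 <= t <= T ->
  evolution O A x p -> hnorm (p t) = 1.
Proof.
move=> /andP[t0 tT] ev; have [p0 pc _] := ev.
have : `|rdot (p t) (p t) - rdot (p 0) (p 0)| <= 0 * (t - 0).
  have sub (h : R -> R) : {within `[0, T], continuous h} ->
      {within `[0, t], continuous h}.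
    by apply: continuous_subspaceW; apply: subset_itv; rewrite bnd_simp.
  (* For two equal inputs the Hamiltonians cancel, so the squared norm has zero derivative off the
     breakpoints. *)
  apply: (@mean_value_breakpoints R (breaks A)
    (fun s => rdot (p s) (p s)) (fun=> 0)) => //.
  - by apply: rdot_continuous => k l; have [/sub pr /sub pi] := pc k l.
  - move=> s /andP[s0 st] sb; have := evolution_derive ev ev _ sb.
    rewrite subrr mul0mx rdotC rdot0r mulr0; apply.
    by rewrite s0 (lt_le_trans st tT).
  - by move=> *; rewrite normr0.
rewrite mul0r normr_le0 subr_eq0 p0 -!hnorm_sqr psi0_unit.
by rewrite eqrXn2 ?ler01 ?hnorm_ge0// => /eqP.
Qed.

Variables (f : input N -> bool) (Gamma : 'M[R]_#|input N|).
Hypothesis adv : adversary_matrix f Gamma.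

Lemma adv_restrict_sym j : (adv_restrict Gamma j)^T = adv_restrict Gamma j.
Proof.
have [sym _ _] := adv; apply/matrixP => a b.
by rewrite !mxE eq_sym -[in LHS]sym mxE.
Qed.

Lemma adv_restrict_ge0 j a b : 0 <= adv_restrict Gamma j a b.
Proof. by have [_ G0 _] := adv; rewrite mxE; case: ifP. Qed.

(** Starting the maximum at 0 makes its nonnegativity immediate. *)
Let maxnorm := \big[Num.max/0]_(j < N) spectral_norm (adv_restrict Gamma j).

Lemma progress_rate (delta : 'I_#|input N| -> R) (p : 'I_#|input N| -> 'cV[R[i]]_d) :
  (forall a, hnorm (p a) = 1) ->
  (forall a, 0 <= delta a) ->
  \sum_a \sum_b Gamma a b * (delta a * delta b) *
    `|rdot ((oracle_ham O (enum_val a) - oracle_ham O (enum_val b)) *m p a)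
           ('i%R *: p b)|
  <= 2 * maxnorm * \sum_a delta a ^+ 2.
Proof.
have [_ G0 _] := adv; move=> p1 d0.
(* With the weights absorbed into [n j], exchanging the sums turns the j-th contribution into the
   quadratic form of [adv_restrict Gamma j]. *)
pose n j a := delta a * hnorm (proj O j *m p a).
apply: (@le_trans _ _ (\sum_j 2 * qform (adv_restrict Gamma j) (n j))).
  rewrite /qform; under [leRHS]eq_bigr do rewrite mulr_sumr.
  rewrite [leRHS]exchange_big/=; apply: ler_sum => a _.
  under [leRHS]eq_bigr do rewrite mulr_sumr.
  rewrite [leRHS]exchange_big/=; apply: ler_sum => b _.
  apply: (le_trans (ler_wpM2l _ (ham_diff_rdot O _ _ _ _))).
    by rewrite mulr_ge0// mulr_ge0.
  rewrite mulr_sumr; apply: ler_sum => j _; rewrite mxE /n -scalemxAr hnorm_imag.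
  move: (hnorm _) (hnorm _) (delta a) (delta b) => na nb da db.
  by case: ifP => _ /=; lra.
apply: (@le_trans _ _ (\sum_j 2 * (maxnorm * \sum_a n j a ^+ 2))).
  apply: ler_sum => j _; rewrite ler_pM2l//.
  apply: (le_trans (qform_le_spectral_norm _ (adv_restrict_sym j) (adv_restrict_ge0 j))).
  apply: ler_wpM2r; first by rewrite sumr_ge0// => a _; rewrite sqr_ge0.
  exact: le_bigmax.
rewrite -!mulr_sumr -mulrA ler_pM2l//; apply: ler_wpM2l; first exact: bigmax_ge_id.
(* Summing over [j] for fixed [a] allows Bessel, so no factor [N] appears. *)
rewrite exchange_big/=; apply: ler_sum => a _.
under eq_bigr do rewrite exprMn.
rewrite -mulr_sumr ler_piMr ?sqr_ge0//.
by rewrite (le_trans (oracle_Bessel _ _))// p1 expr1n.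
Qed.

Lemma final_overlap (T : R) (A : algorithm d T) x y u v : f x != f y ->
  hnorm u = 1 -> hnorm v = 1 ->
  2 / 3 <= output_prob A u (f x) -> 2 / 3 <= output_prob A v (f y) ->
  rdot u v <= 33 / 35.
Proof.
have := povm_sum A.
case: (f x) (f y) => -[]// sumE _ u1 v1 hu hv.
  apply: povm_overlap (povm_psd A true) (povm_psd A false) _ u1 v1 hu hv.
  by rewrite addrC.
exact: povm_overlap (povm_psd A false) (povm_psd A true) sumE u1 v1 hu hv.
Qed.

Lemma time_bound (T : R) (A : algorithm d T) (delta : 'I_#|input N| -> R) :
  0 <= T -> computes O A f -> (forall a, 0 <= delta a) ->
  qform Gamma delta <= 35 * (maxnorm * (\sum_a delta a ^+ 2) * T).
Proof.
move=> T0 cf d0; have [_ G0 Gf] := adv.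
have /choice[psi hpsi] : forall a : 'I_#|input N|, exists p,
    evolution O A (enum_val a) p /\
    2 / 3 <= output_prob A (p T) (f (enum_val a)).
  by move=> a; have [p ? ?] := cf (enum_val a); exists p.
have ev a : evolution O A (enum_val a) (psi a) by have [] := hpsi a.
have w0 a b : 0 <= Gamma a b * (delta a * delta b) by rewrite mulr_ge0// mulr_ge0.
pose W t := \sum_a \sum_b Gamma a b * (delta a * delta b) * rdot (psi a t) (psi b t).
pose dW t := \sum_a \sum_b Gamma a b * (delta a * delta b) * (gain A t *
  rdot ((oracle_ham O (enum_val a) - oracle_ham O (enum_val b)) *m psi a t)
       ('i%R *: psi b t)).
have W0 : W 0 = qform Gamma delta.
  apply: eq_bigr => a _; apply: eq_bigr => b _.
  have [-> _ _] := ev a; have [-> _ _] := ev b.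
  by rewrite -hnorm_sqr psi0_unit expr1n mulr1.
have WT : W T <= 33 / 35 * qform Gamma delta.
  rewrite mulr_sumr; apply: ler_sum => a _; rewrite mulr_sumr; apply: ler_sum => b _.
  rewrite mulrC; have [fab|fab] := eqVneq (f (enum_val a)) (f (enum_val b)).
    by rewrite Gf// mul0r !mulr0.
  apply: ler_wpM2r => //; apply: (@final_overlap T A _ _ _ _ fab).
  - by apply: evolution_norm (ev a); rewrite T0 lexx.
  - by apply: evolution_norm (ev b); rewrite T0 lexx.
  - by case: (hpsi a).
  - by case: (hpsi b).
have : `|W T - W 0| <= 2 * maxnorm * (\sum_a delta a ^+ 2) * (T - 0).
  apply: (@mean_value_breakpoints R (breaks A) W dW) => //.
  - apply: within_continuous_sum => a; apply: within_continuous_sum => b.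
    apply: within_continuous_mul; first by move=> t; apply: cvg_cst.
    by have [_ ca _] := ev a; have [_ cb _] := ev b; apply: rdot_continuous.
  - move=> t tT tb.
    (* A sum of functions, as [is_derive_sum] expects. *)
    have -> : W = \sum_a \sum_b (fun s => Gamma a b * (delta a * delta b) *
        rdot (psi a s) (psi b s)).
      apply/funext => s; rewrite fct_sumE; apply: eq_bigr => a _.
      by rewrite fct_sumE.
    apply: is_derive_sum => a; apply: is_derive_sum => b.
    have := evolution_derive (ev a) (ev b) tT tb; exact: is_deriveZ.
  - move=> t /andP[t0 tT] tb.
    have t0T : 0 <= t <= T by rewrite !ltW.
    apply: le_trans (progress_rate (fun a => evolution_norm t0T (ev a)) d0).
    apply: (le_trans (ler_norm_sum _ _ _)); apply: ler_sum => a _.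
    apply: (le_trans (ler_norm_sum _ _ _)); apply: ler_sum => b _.
    rewrite normrM (ger0_norm (w0 _ _)); apply: ler_wpM2l => //.
    by rewrite normrM ler_piMl ?gain_le1.
(* A loss of at least 2/35 of [W 0] at rate at most [2 * maxnorm * D], with [D] the sum of squares
   of [delta], gives the factor 35. *)
rewrite W0 subr0 ler_norml => /andP[h _].
move: h WT; move: (W T) (qform _ _) => z q; clear.
move: (\sum_a _) => D h WT; lra.
Qed.
End Adversary.

Theorem theorem3p1 (R : realType) :
  exists c : R, 0 < c /\
    forall (N d : nat) (O : oracle R N d) (f : input N -> bool)
      (Gamma : 'M[R]_#|input N|),
    (0 < N)%N -> adversary_matrix f Gamma -> Gamma != 0 ->
    ((c * (spectral_norm Gamma /
           \big[Num.max/0]_(j < N) spectral_norm (adv_restrict Gamma j)))%:E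
      <= Q2 O f)%E.
Proof.
exists 35^-1; split; first by rewrite invr_gt0.
move=> N d O f Gamma _ adv _; set m := \big[_/_]_(j < N) _.
(* A lower bound on an infimum is checked on each feasible [T]; if there is none, [Q2] is [+oo]. *)
apply: le_ereal_inf_tmp => _ [T [T0 [A cA]] <-]; rewrite lee_fin.
(* If [m = 0], the quotient is 0 by convention and the claim is [0 <= T]. *)
have [m0|m0] := eqVneq m 0; first by rewrite m0 invr0 !mulr0.
have mp : 0 < m by rewrite lt0r m0 bigmax_ge_id.
rewrite mulrA ler_pdivrMr// mulrC ler_pdivrMr//.
have [sym G0 _] := adv.
have bound s : 0 <= s -> eigenvalue (Gamma^T *m Gamma) (s ^+ 2) -> s <= T * m * 35.
  move=> s0 /(nonneg_witness sym G0 s0)[v [v0 vp sv]].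
  rewrite -(ler_pM2r vp) (le_trans sv)// (le_trans (time_bound adv T0 cA v0))//.
  by rewrite le_eqVlt; apply/orP; left; apply/eqP; rewrite -/m; ring.
(* [ge_sup] requires a nonempty set; the [sup] of the empty set is 0. *)
have [[s hs]|/set0P/negP/negPn/eqP E] := pselect ([set s | 0 <= s /\
    eigenvalue (Gamma^T *m Gamma) (s ^+ 2)] !=set0).
  by apply: ge_sup => [|r [r0 rE]]; [exists s|exact: bound].
by rewrite /spectral_norm E sup0 !mulr_ge0// ltW.
Qed.
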